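(* Let $\mu_+$ and $\nu_-$ be probability measures on $\mathbb{Z}$ with $\mathrm{Supp}(\mu_+)\subset\mathbb{N}^*$ and $\mathrm{Supp}(\nu_-)\subset-\mathbb{N}^*$, and let $(Z_n)_{n\ge0}$ be the Markov chain on $\mathbb{Z}$ whose jumps have law $\mu_+$ at every point of $(-\infty,0]$ and law $\nu_-$ at every point of $[1,+\infty)$. Let $G^Z(0,0)=\sum_{n\ge0}P_0(Z_n=0)\in[1,+\infty]$. (i) One has $$G^Z(0,0)=\sum_{m\ge0}G^{\mu_+}(0,m)\,G^{\nu_-}(0,-m)$$ and $$G^Z(0,0)=\lim_{s\uparrow1}\frac{1}{2\pi}\int_0^{2\pi}\mathrm{Re}\left(\frac{1}{1-s\hat\mu_+(t)}\cdot\frac{1}{1-s\hat\nu_-(t)}\right)dt.$$ (ii) If $\nu_-(A)=\mu_+(-A)$ for all $A\subset\mathbb{Z}$, then $$G^Z(0,0)=\frac{1}{2\pi}\int_0^{2\pi}\frac{dt}{|1-\hat\mu_+(t)|^{2}}.$$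
   Context: $\mathbb{N}^*=\{1,2,3,\dots\}$. For a probability measure $w$ on $\mathbb{Z}$, $\hat w(t)=\sum_{k}w(k)e^{itk}$, and $G^{w}(0,y)=\sum_{n\ge0}P(S_n^{w}=y)$, where $S_n^w$ is the sum of $n$ i.i.d. random variables with law $w$ ($S_0^w=0$). $P_x$ denotes probability for the chain started at $x$. ''The jumps have law $w$ at $x$'' means that from $x$ the chain moves to $x+k$ with probability $w(k)$. All equalities hold in $[0,+\infty]$. *)

(* Defs.v *)
From HB Require Import structures.
From mathcomp Require Import all_boot all_order all_algebra finmap.
From mathcomp Require Import complex.
From mathcomp Require Import all_classical all_reals all_analysis.

Set Implicit Arguments.
Unset Strict Implicit.
Unset Printing Implicit Defensive.

Import Order.TTheory GRing.Theory Num.Theory.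
Import numFieldNormedType.Exports.

Local Open Scope classical_set_scope.
Local Open Scope ring_scope.

(* int carries the discrete sigma-algebra, so a probability measure on Z is an
   inhabitant of [probability int R]. *)
HB.instance Definition _ := isPointed.Build int 0.

HB.instance Definition _ := @isMeasurable.Build default_measure_display
  int discrete_measurable discrete_measurable0
  discrete_measurableC discrete_measurableU.

Definition mass_support (R : realType) (w : probability int R) : set int :=
  [set k | w [set k] != 0%E].

(* \hat w(t) = \sum_(k in Z) w(k) e^(itk); the absolutely convergent sum over Z
   is the integral against the counting measure, taken on the real and
   imaginary parts of w(k) e^(itk). *)
Definition fourier (R : realType) (w : probability int R) (t : R) : R[i] :=
  Complex
    (\int[counting]_(k in [set: int]) (fine (w [set k]) * cos (t * k%:~R)))
    (\int[counting]_(k in [set: int]) (fine (w [set k]) * sin (t * k%:~R))).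

Definition mutually_independent (d d' : measure_display)
    (T : measurableType d) (E : measurableType d') (R : realType)
    (P : probability T R) (X : nat -> {RV P >-> E}) : Prop :=
  forall (J : {fset nat}) (A : nat -> set E), (forall i, measurable (A i)) ->
    P (\bigcap_(i in [set` J]) (X i @^-1` A i)) =
    (\prod_(i <- J) P (X i @^-1` A i))%E.

Definition iid_with_law (d : measure_display) (T : measurableType d)
    (R : realType) (P : probability T R) (X : nat -> {RV P >-> int})
    (w : probability int R) : Prop :=
  mutually_independent X /\
  forall (i : nat) (A : set int), distribution P (X i) A = w A.

Definition walk (T : Type) (X : nat -> T -> int) (n : nat) (omega : T) : int :=
  \sum_(i < n) X i omega.

Definition green (d : measure_display) (T : measurableType d) (R : realType)
    (P : probability T R) (S : nat -> T -> int) (y : int) : \bar R :=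
  (\sum_(0 <= n <oo) P (S n @^-1` [set y]))%E.

(* The Markov property is in product form, P(Z_0 = z_0, .., Z_(n+1) = z_(n+1)) =
   P(Z_0 = z_0, .., Z_n = z_n) p(z_n, z_(n+1)), which needs no conditioning on
   null events; here p(x, y) = jump x (y - x). *)
Definition markov_chain_from (d : measure_display) (T : measurableType d)
    (R : realType) (P : probability T R) (jump : int -> probability int R)
    (x : int) (Z : nat -> {RV P >-> int}) : Prop :=
  P (Z 0%N @^-1` [set x]) = 1%E /\
  forall (n : nat) (z : nat -> int),
    P (\bigcap_(i in `I_n.+2) (Z i @^-1` [set z i])) =
    (P (\bigcap_(i in `I_n.+1) (Z i @^-1` [set z i])) *
     jump (z n) [set (z n.+1 - z n)%R])%E.

Definition oscillating_jump (R : realType) (mu nu : probability int R)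
    (x : int) : probability int R :=
  if x <= 0 then mu else nu.

(* Main.v *)
Require Import Defs.
From mathcomp Require Import all_boot all_order all_algebra finmap.
From mathcomp Require Import complex.
From mathcomp Require Import all_classical all_reals all_analysis.
From mathcomp Require Import measurable_realfun.
From mathcomp Require Import zify ring lra.

Set Implicit Arguments.
Unset Strict Implicit.
Unset Printing Implicit Defensive.

Import Order.TTheory GRing.Theory Num.Theory.
Import numFieldNormedType.Exports.

Local Open Scope classical_set_scope.
Local Open Scope ring_scope.

(* At [x <= 0] the backward equation of the oscillating chain convolves with
   [mu], at [x >= 1] with [nu].  Both cases are solved at once by
     P_x(Z_n = 0) = \sum_(k + l = n) (mu^{*k} * nu^{*l})(- x),
   because the only term of rank [n + 1] without a factor [mu] (resp. [nu]) is
   [nu^{*(n+1)}(- x)] (resp. [mu^{*(n+1)}(- x)]), which vanishes by the support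
   conditions.  Weighting by [s^n] and summing over [n] gives
   [(A_s * B_s)(0)], with [A_s = \sum_k s^k mu^{*k}] and
   [B_s = \sum_l s^l nu^{*l}]: this is the first formula for [s = 1].  For
   [s < 1], [A_s] and [B_s] are summable with Fourier transforms
   [(1 - s \hat mu)^-1] and [(1 - s \hat nu)^-1], so that Fourier inversion and
   Abel's theorem give the second formula.  In the reflected case the integrand
   is [|1 - s \hat mu|^-2 <= 4 |1 - \hat mu|^-2], and the limit passes under the
   integral sign by dominated convergence, or by Fatou's lemma if the limit
   integral is infinite. *)

(** * Sums over the integers *)

Section counting_int.
Context {R : realType}.
Local Open Scope ereal_scope.
Implicit Types a b : int -> \bar R.

(** An enumeration of the integers turns integrals against the counting measure into series over
    [nat], for which countable additivity and termwise integration are at hand. *)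
Lemma bij_nat_int : exists e : nat -> int, set_bij setT setT e.
Proof.
apply/card_set_bijP; rewrite card_eq_sym; apply: eq_card_nat;
  first exact: countableP.
apply/infiniteP/pcard_leTP/injPex; exists Posz => // m n _ _.
by case.
Qed.

Lemma ge0_counting_series (e : nat -> int) a : set_bij setT setT e ->
  (forall k, 0 <= a k) ->
  \int[counting]_k a k = \sum_(n <oo) a (e n).
Proof.
move=> ebij a0.
have eE : [set: int] = \bigcup_n [set e n].
  by apply/seteqP; split => k // _; have [_ _ /(_ k I)[n _ <-]] := ebij;
    exists n.
rewrite eE ge0_integral_bigcup//=.
  apply: eq_eseriesr => n _.
  rewrite (eq_integral (cst (a (e n)))); last by move=> k /set_mem ->.
  rewrite integral_cst//= /counting asboolT ?finite_set1// fset_set1 cardfs1.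
  by rewrite mule1.
move=> m n _ _ [k [/= -> ]].
by apply: (set_bij_inj ebij); rewrite inE.
Qed.

Lemma ge0_counting_esum a : (forall k, 0 <= a k) ->
  \int[counting]_k a k = \esum_(k in setT) a k.
Proof.
move=> a0; have [e ebij] := bij_nat_int.
rewrite (ge0_counting_series ebij)// nneseries_esumT//.
by rewrite (reindex_esum _ _ _ _ ebij).
Qed.

Lemma ge0_counting_reindex (f : int -> int) a : bijective f ->
  (forall k, 0 <= a k) ->
  \int[counting]_k a (f k) = \int[counting]_k a k.
Proof.
move=> [g fK gK] a0; rewrite !ge0_counting_esum//; apply/esym.
apply: (@reindex_esum _ _ _ setT); split => //.
- by move=> m n _ _; exact: (can_inj fK).
- by move=> k _; exists (g k).
Qed.

(** The signed case, which the cosine and sine sums of a reflected law require, follows from the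
    nonnegative one applied to the positive and negative parts. *)
Lemma counting_reindex (f : int -> int) a : bijective f ->
  \int[counting]_k a (f k) = \int[counting]_k a k.
Proof.
move=> fbij; rewrite integralE [RHS]integralE.
rewrite -(ge0_counting_reindex fbij (funepos_ge0 a)).
rewrite -(ge0_counting_reindex fbij (funeneg_ge0 a)).
congr (_ - _); apply: eq_integral => k _.
  by rewrite !funeposE.
by rewrite !funenegE.
Qed.

(** Both iterated integrals are unordered sums over pairs, so that the exchange is a reindexing by
    the transposition. *)
Lemma ge0_counting_swap (f : int -> int -> \bar R) : (forall i j, 0 <= f i j) ->
  \int[counting]_i \int[counting]_j f i j =
  \int[counting]_j \int[counting]_i f i j.
Proof.
move=> f0.
rewrite !ge0_counting_esum//; try by move=> k; exact: integral_ge0.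
under eq_esum do rewrite ge0_counting_esum//.
under [RHS]eq_esum do rewrite ge0_counting_esum//.
rewrite !esum_esum//.
apply: (@reindex_esum _ _ _ _ _ (fun x => (x.2, x.1))); split => //=.
- by move=> [m n] [p q] _ _ [-> ->].
- by move=> [i j] _; exists (j, i).
Qed.

Lemma ge0_countingZl a c : 0 <= c -> (forall k, 0 <= a k) ->
  \int[counting]_k (c * a k) = c * \int[counting]_k a k.
Proof. by move=> c0 a0; rewrite ge0_integralZl. Qed.

Lemma ge0_countingD a b : (forall k, 0 <= a k) -> (forall k, 0 <= b k) ->
  \int[counting]_k (a k + b k) = \int[counting]_k a k + \int[counting]_k b k.
Proof. by move=> a0 b0; rewrite ge0_integralD. Qed.

Lemma ge0_counting_delta a k : (forall k, 0 <= a k) ->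
  \int[counting]_j ((j == k)%:R%:E * a j) = a k.
Proof.
move=> a0; rewrite ge0_counting_esum; last by move=> j; rewrite mule_ge0.
rewrite (@esumID _ _ [set k])// => [|j _]; last by rewrite mule_ge0.
rewrite setTI esum_set1 ?mule_ge0// eqxx mul1e esum1 ?adde0// => j [_ /= /eqP].
by move/negPf ->; rewrite mul0e.
Qed.

Lemma ge0_counting_nat a : (forall k, 0 <= a k) ->
  (forall k, (k < 0)%R -> a k = 0) ->
  \int[counting]_k a k = \sum_(n <oo) a n%:Z.
Proof.
move=> a0 aneg; rewrite ge0_counting_esum// (@esumID _ _ (range Posz))//.
rewrite setTI [X in _ + X]esum1 ?adde0 => [|k [_ kn]]; last first.
  by apply: aneg; case: k kn => // n [] ; exists n.
rewrite esum_image; last by move=> m n _ _ [].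
by rewrite nneseries_esumT.
Qed.

Lemma ge0_nneseriesZl (c : \bar R) (f : nat -> \bar R) : 0 <= c ->
  (forall k, 0 <= f k) -> \sum_(k <oo) (c * f k) = c * \sum_(k <oo) f k.
Proof.
move=> c0 f0; rewrite -!ge0_integral_count// => [|k]; last by rewrite mule_ge0.
by rewrite ge0_integralZl.
Qed.

End counting_int.

(** * Convolution *)

Section convolution.
Context {R : realType}.
Local Open Scope ereal_scope.
Implicit Types a b c : int -> \bar R.

Definition conv a b (n : int) : \bar R :=
  \int[counting]_m (a m * b (n - m)%R).

Definition delta0 (n : int) : \bar R := (n == 0)%:R%:E.

Definition convpow a k := iter k (conv a) delta0.

Lemma convpow0 a : convpow a 0 = delta0. Proof. by []. Qed.

Lemma convpowS a k : convpow a k.+1 = conv a (convpow a k). Proof. by []. Qed.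

Lemma delta0_ge0 n : 0 <= delta0 n.
Proof. by rewrite lee_fin. Qed.

Lemma conv_ge0 a b : (forall k, 0 <= a k) -> (forall k, 0 <= b k) ->
  forall n, 0 <= conv a b n.
Proof. by move=> a0 b0 n; apply: integral_ge0 => k _; rewrite mule_ge0. Qed.

Lemma convpow_ge0 a k : (forall k, 0 <= a k) -> forall n, 0 <= convpow a k n.
Proof.
by move=> a0; elim: k => [|k ih]; [exact: delta0_ge0|exact: conv_ge0].
Qed.

Lemma conv_delta0 a : (forall k, 0 <= a k) -> conv delta0 a = a.
Proof.
move=> a0; apply/funext => n.
rewrite /conv /delta0 (ge0_counting_delta (a := fun m => a (n - m)%R))//.
by rewrite subr0.
Qed.

(** Exchange the two sums, then shift by $n = m + j$. Taking for [c] the constant 1, a reflected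
    translate, or a shifted trigonometric function yields the total mass, associativity and the
    Fourier transform of a convolution. *)
Lemma conv_test a b c : (forall k, 0 <= a k) -> (forall k, 0 <= b k) ->
  (forall k, 0 <= c k) ->
  \int[counting]_n (conv a b n * c n) =
  \int[counting]_m (a m * \int[counting]_j (b j * c (m + j)%R)).
Proof.
move=> a0 b0 c0.
transitivity (\int[counting]_(n in [set: int]) \int[counting]_m (a m * (b (n -
  m)%R * c n))).
  apply: eq_integral => n _; rewrite muleC -ge0_countingZl//; last first.
    by move=> m; rewrite mule_ge0.
  by apply: eq_integral => m _; rewrite muleC muleA.
rewrite ge0_counting_swap; last by move=> *; rewrite !mule_ge0.
apply: eq_integral => m _; rewrite ge0_countingZl//; last first.
  by move=> *; rewrite !mule_ge0.
congr (_ * _).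
rewrite -(@ge0_counting_reindex _ (fun j => m + j)%R); last 2 first.
- by exists (fun j => j - m)%R => j; ring.
- by move=> *; rewrite !mule_ge0.
by apply: eq_integral => j _; rewrite addrAC subrr add0r.
Qed.

Lemma conv_total a b : (forall k, 0 <= a k) -> (forall k, 0 <= b k) ->
  \int[counting]_n conv a b n = \int[counting]_m a m * \int[counting]_j b j.
Proof.
move=> a0 b0; transitivity (\int[counting]_n (conv a b n * 1)).
  by apply: eq_integral => n _; rewrite mule1.
rewrite (conv_test (c := fun=> 1))//=.
rewrite muleC -ge0_countingZl//; last exact: integral_ge0.
apply: eq_integral => m _; rewrite muleC; congr (_ * _).
by apply: eq_integral => j _; rewrite mule1.
Qed.

Lemma conv_lty a b : (forall k, 0 <= a k) -> (forall k, 0 <= b k) ->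
  \int[counting]_k a k < +oo -> \int[counting]_k b k < +oo ->
  \int[counting]_k conv a b k < +oo.
Proof.
move=> a0 b0 aoo boo; have ai :
  0 <= \int[counting]_k a k by exact: integral_ge0.
by rewrite conv_total// lte_mul_pinfty// ge0_fin_numE.
Qed.

Lemma convC a b : (forall k, 0 <= a k) -> (forall k, 0 <= b k) ->
  conv a b = conv b a.
Proof.
move=> a0 b0; apply/funext => n; rewrite /conv.
rewrite -(@ge0_counting_reindex _ (fun j => n - j)%R); last 2 first.
- by exists (fun j => n - j)%R => j; ring.
- by move=> *; rewrite !mule_ge0.
by apply: eq_integral => j _; rewrite subKr muleC.
Qed.

Lemma convA a b c : (forall k, 0 <= a k) -> (forall k, 0 <= b k) ->
  (forall k, 0 <= c k) -> conv (conv a b) c = conv a (conv b c).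
Proof.
move=> a0 b0 c0; apply/funext => n.
have /= := @conv_test a b (fun m => c (n - m)%R) a0 b0 (fun=> c0 _).
move=> abc; rewrite -/(conv (conv a b) c n) in abc; rewrite abc.
apply: eq_integral => m _; congr (_ * _).
by apply: eq_integral => j _; rewrite opprD addrA.
Qed.

Lemma conv_nneseries (f g : nat -> int -> \bar R) n :
  (forall k m, 0 <= f k m) -> (forall k m, 0 <= g k m) ->
  conv (fun m => \sum_(k <oo) f k m) (fun m => \sum_(l <oo) g l m) n =
  \sum_(k <oo) \sum_(l <oo) conv (f k) (g l) n.
Proof.
move=> f0 g0; rewrite /conv.
transitivity (\int[counting]_(m in [set: int]) \sum_(k <oo) \sum_(l <oo) (f k m
  * g l (n - m)%R)).
  apply: eq_integral => m _.
  rewrite muleC -ge0_nneseriesZl//; last exact: nneseries_ge0.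
  by apply: eq_eseriesr => k _; rewrite muleC -ge0_nneseriesZl.
rewrite integral_nneseries//; last by move=> k m _; apply: nneseries_ge0 => *;
  rewrite mule_ge0.
apply: eq_eseriesr => k _.
by rewrite integral_nneseries// => l m _; rewrite mule_ge0.
Qed.

Lemma convpow_total a k : (forall k, 0 <= a k) -> \int[counting]_n a n = 1 ->
  \int[counting]_n convpow a k n = 1.
Proof.
move=> a0 a1; elim: k => [|k ih] /=; last first.
  by rewrite conv_total ?a1 ?mul1e//; exact: convpow_ge0.
rewrite -[RHS](@ge0_counting_delta _ (fun=> 1) 0%R)//=.
by apply: eq_integral => k _; rewrite mule1.
Qed.

(** A sum of $k$ steps, each at least 1, is at least $k$. *)
Lemma convpow_eq0_le a k (n : int) : (forall k : int, (k <= 0)%R -> a k = 0) ->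
  (n < k%:Z)%R -> convpow a k n = 0.
Proof.
move=> a0; elim: k n => [|k ih] n nk /=.
  by rewrite /delta0 (_ : (n == 0%R) = false)//; lia.
apply: integral0_eq => m _; have [m0|m0] := leP m 0%R.
  by rewrite a0// mul0e.
by rewrite ih ?mule0//; lia.
Qed.

Lemma convpow_eq0_ge a k (n : int) : (forall k : int, (0 <= k)%R -> a k = 0) ->
  (- k%:Z < n)%R -> convpow a k n = 0.
Proof.
move=> a0; elim: k n => [|k ih] n nk /=.
  by rewrite /delta0 (_ : (n == 0%R) = false)//; lia.
apply: integral0_eq => m _; have [m0|m0] := leP 0%R m.
  by rewrite a0// mul0e.
by rewrite ih ?mule0//; lia.
Qed.

End convolution.

Arguments convpow : simpl never.

(** * Hitting probabilities *)

Section hitting_probabilities.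
Context {R : realType}.
Local Open Scope ereal_scope.

(** This is $P_x(Z_n = y)$ for the chain that jumps from $x$ by $j$ with probability [J x j],
    computed by the backward equation, that is by splitting according to the first jump. *)
Fixpoint hit (J : int -> int -> \bar R) (y : int) (n : nat) (x : int) :
  \bar R :=
  if n is n'.+1 then \int[counting]_j (J x j * hit J y n' (x + j)%R)
  else (x == y)%:R%:E.

Lemma hit_ge0 J y n x : (forall x j, 0 <= J x j) -> 0 <= hit J y n x.
Proof.
move=> J0; elim: n x => [|n ih] x; first by rewrite lee_fin.
by apply: integral_ge0 => j _; rewrite mule_ge0.
Qed.

Lemma hit_walk (w : int -> \bar R) y n x :
  hit (fun=> w) y n x = convpow w n (y - x)%R.
Proof.
elim: n x => [|n ih] x /=; first by rewrite convpow0 /delta0 subr_eq0 eq_sym.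
rewrite convpowS; by apply: eq_integral => j _; rewrite ih opprD addrA.
Qed.

(** Both sides are unordered sums, matched by the bijection $(k, l) \mapsto (k + l, k)$ onto the
    pairs $(n, k)$ with $k \le n$. *)
Lemma nneseries_cauchy (f : nat -> nat -> \bar R) : (forall k l, 0 <= f k l) ->
  \sum_(n <oo) \sum_(k < n.+1) f k (n - k)%N = \sum_(k <oo) \sum_(l <oo) f k l.
Proof.
move=> f0.
transitivity (\esum_(n in [set: nat]) \esum_(k in `I_n.+1) f k (n - k)%N).
  rewrite nneseries_esumT => [|n]; last exact: sume_ge0.
  by apply: eq_esum => n _; rewrite esum_fset// -fsbig_ord.
transitivity (\esum_(k in [set: nat]) \esum_(l in [set: nat]) f k l).
  rewrite !esum_esum//.
  rewrite (@reindex_esum _ _ _ ([set: nat] `*`` fun=> [set: nat]) _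
    (fun x => ((x.1 + x.2)%N, x.1)))/=; last first.
    split => [[k l] _ /=|[k l] [k' l'] _ _ [] + kk'|[n k] [_ /= kn]].
    - by split => //; rewrite /mkset ltnS leq_addr.
    - by rewrite kk' => /addnI ->.
    - by exists (k, (n - k)%N) => //=; rewrite subnKC.
  by apply: eq_esum => -[k l] _ /=; rewrite addKn.
rewrite nneseries_esumT => [|n]; last exact: nneseries_ge0.
by apply: eq_esum => k _; rewrite nneseries_esumT.
Qed.

(** This is the measure $A_s$ or $B_s$ of the overview; at $s = 1$ it is the Green function of the
    walk with step law [w]. *)
Definition genf (w : int -> \bar R) (s : R) (m : int) : \bar R :=
  \sum_(k <oo) (s ^+ k)%:E * convpow w k m.

Lemma genf_ge0 w s m : (forall k, 0 <= w k) -> (0 <= s)%R -> 0 <= genf w s m.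
Proof.
move=> w0 s0; apply: nneseries_ge0 => k _ _.
by rewrite mule_ge0 ?convpow_ge0// lee_fin exprn_ge0.
Qed.

Section oscillating.
Variables mu nu : int -> \bar R.
Hypotheses (mu0 : forall k, 0 <= mu k) (nu0 : forall k, 0 <= nu k).
Hypotheses (mu_pos : forall k : int, (k <= 0)%R -> mu k = 0).
Hypotheses (nu_neg : forall k : int, (0 <= k)%R -> nu k = 0).

Let J (x : int) := if (x <= 0)%R then mu else nu.

Let c n (y : int) :=
  \sum_(k < n.+1) conv (convpow mu k) (convpow nu (n - k)) y.

(* Of the n.+2 terms of [c n.+1 (- x)], those with at least one factor [mu] add
   up to [conv mu (c n)] and those with at least one factor [nu] to
   [conv nu (c n)]; the support conditions kill the one term left over. *)
Lemma hit_oscillating n x : hit J 0%R n x =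
  \sum_(k < n.+1) conv (convpow mu k) (convpow nu (n - k)) (- x)%R.
Proof.
rewrite -/(c n (- x)%R); elim: n x => [|n ih] x /=.
  rewrite /c big_ord_recr big_ord0/= add0e convpow0 conv_delta0;
    last exact: delta0_ge0.
  by rewrite convpow0 /delta0 oppr_eq0.
have pm := convpow_ge0 _ mu0; have pn := convpow_ge0 _ nu0.
under eq_integral do rewrite ih opprD.
rewrite /c /J; case: leP => x0.
  (* For $x \le 0$ the term left over is $k = 0$: $\nu^{*(n+1)}$ lives on $(-\infty, -(n+1)]$, which
     misses $-x \ge 0$. *)
  rewrite big_ord_recl/= convpow0 conv_delta0// subn0 convpow_eq0_ge// ?add0e;
    last by lia.
  transitivity (\sum_(k < n.+1) \int[counting]_j
     (mu j * conv (convpow mu k) (convpow nu (n - k)) (- x - j)%R)).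
    rewrite -ge0_integral_sum//; last first.
      by move=> *; rewrite mule_ge0// conv_ge0.
    apply: eq_integral => j _; rewrite ge0_sume_distrr// => k _.
    exact: conv_ge0.
  by apply: eq_bigr => k _; rewrite convpowS convA.
(* For $x \ge 1$ the term left over is $k = n + 1$: $\mu^{*(n+1)}$ lives on $[n+1, +\infty)$, which
   misses $-x < 0$. *)
rewrite big_ord_recr/= subnn convpow0 convC//; last exact: delta0_ge0.
rewrite conv_delta0; last exact: (pm n.+1).
rewrite [X in _ + X](convpow_eq0_le (k := n.+1))// ?adde0; last by lia.
transitivity (\sum_(k < n.+1) \int[counting]_j
   (nu j * conv (convpow mu k) (convpow nu (n - k)) (- x - j)%R)).
  rewrite -ge0_integral_sum//; last first.
    by move=> *; rewrite mule_ge0// conv_ge0.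
  apply: eq_integral => j _; rewrite ge0_sume_distrr// => k _.
  exact: conv_ge0.
(* The new factor [nu] enters in front of $\mu^{*k}$ and has to be commuted past it to join
   $\nu^{*(n-k)}$. *)
apply: eq_bigr => k _; rewrite subSn ?convpowS; last by rewrite -ltnS.
rewrite (convC (pm k) (pn (n - k)%N)) -/(conv nu _ _) -convA//.
by rewrite [in RHS](convC (pm k)) //=; exact: conv_ge0.
Qed.

(** Writing $s^n = s^k s^{n-k}$ makes the sum over $n$ a Cauchy product. The case $s = 1$ is
    included and gives the first formula; the cases $s < 1$ feed the Fourier argument. *)
Lemma nneseries_hit_oscillating (s : R) : (0 <= s)%R ->
  \sum_(n <oo) (s ^+ n)%:E * hit J 0%R n 0%R = conv (genf mu s) (genf nu s) 0%R.
Proof.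
move=> s0; have pm := convpow_ge0 _ mu0; have pn := convpow_ge0 _ nu0.
have sk k : 0 <= (s ^+ k)%:E by rewrite lee_fin exprn_ge0.
rewrite conv_nneseries; [|by move=> *; rewrite mule_ge0..].
rewrite -nneseries_cauchy; last first.
  by move=> *; apply: conv_ge0 => *; rewrite mule_ge0.
apply: eq_eseriesr => n _.
rewrite hit_oscillating oppr0 ge0_sume_distrr => [|k _]; last exact: conv_ge0.
apply: eq_bigr => k _.
rewrite /conv -ge0_countingZl//; last by move=> *; rewrite mule_ge0.
apply: eq_integral => m _; rewrite muleACA -EFinM -exprD subnKC//.
by rewrite -ltnS.
Qed.

End oscillating.

(** The renewal equation $A_s = \delta_0 + s\, w * A_s$, obtained by splitting off the term $k = 0$.
    Transforming it gives the resolvent without summing a complex geometric series. *)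
Lemma genf_rec w s m : (forall k, 0 <= w k) -> (0 <= s)%R ->
  genf w s m = delta0 m + s%:E * conv w (genf w s) m.
Proof.
move=> w0 s0; have pw := convpow_ge0 _ w0.
have sk k : 0 <= (s ^+ k)%:E by rewrite lee_fin exprn_ge0.
rewrite /genf nneseries_recl//=; last by move=> k _; rewrite mule_ge0.
rewrite expr0 mul1e; congr (_ + _).
rewrite -nneseries_addn; last by move=> k; rewrite mule_ge0.
rewrite -ge0_countingZl//; last first.
  by move=> j; rewrite mule_ge0// genf_ge0.
transitivity (\int[counting]_(j in [set: int])
  \sum_(k <oo) (s ^+ k.+1)%:E * (w j * convpow w k (m - j)%R)).
  rewrite integral_nneseries//; last by move=> *; rewrite !mule_ge0.
  apply: eq_eseriesr => k _; rewrite addn1/= -ge0_countingZl//.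
  by move=> *; rewrite mule_ge0.
apply: eq_integral => j _; rewrite -ge0_nneseriesZl//; last first.
  by move=> k; rewrite mule_ge0.
rewrite -ge0_nneseriesZl//; last by move=> k; rewrite !mule_ge0.
by apply: eq_eseriesr => k _; rewrite exprS EFinM -muleA (muleCA (w j)).
Qed.

End hitting_probabilities.

(** * Markov chains and random walks *)

Section chains.
Context d (T : measurableType d) (R : realType) (P : probability T R).
Local Open Scope ereal_scope.

Lemma measurable_preimage_int (f : T -> int) (B : set int) :
  measurable_fun setT f -> measurable (f @^-1` B).
Proof. by move=> mf; rewrite -[_ @^-1` _]setTI; exact: mf. Qed.

Lemma probability_partition (f : T -> int) (A : set T) :
  measurable_fun setT f -> measurable A ->
  P A = \int[counting]_j P (A `&` f @^-1` [set j]).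
Proof.
move=> mf mA; have [e ebij] := bij_nat_int.
rewrite (ge0_counting_series ebij)//.
have {1}-> : A = \bigcup_(n in setT) (A `&` f @^-1` [set e n]).
  rewrite -setI_bigcupr; apply/esym/setIidPl => t _.
  by have [_ _ /(_ (f t) I)[n _ enf]] := ebij; exists n => //=; rewrite enf.
rewrite measure_bigcup; first last.
- move=> m n _ _ [t [[_ /= ->] [_ /=]]].
  by apply: (set_bij_inj ebij); rewrite inE.
- move=> n _; apply: measurableI => //; exact: measurable_preimage_int.
by apply: eq_eseriesl => n; rewrite in_setT.
Qed.

Lemma probability_setI1 (A B : set T) : measurable A -> measurable B ->
  P A = 1 -> P (A `&` B) = P B.
Proof.
move=> mA mB PA; have mAB := measurableI _ _ mA mB.
apply/eqP; rewrite eq_le; apply/andP; split.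
  by apply: le_measure; rewrite ?inE//; exact: subIsetr.
have -> : P (A `&` B) = P (A `&` B) + P (~` A).
  by rewrite probability_setC// PA subee// adde0.
apply: le_trans (measureU2 _ mAB (measurableC mA)).
apply: le_measure; rewrite ?inE//; first exact/measurableU/measurableC.
by move=> t Bt; have [|] := pselect (A t); [left|right].
Qed.

Section hitting.
Variables (Z : nat -> T -> int) (J : int -> int -> \bar R).
Hypothesis mZ : forall n, measurable_fun setT (Z n).
Hypothesis J0 : forall x j, 0 <= J x j.
Hypothesis chainZ : forall n z,
  P (\bigcap_(i in `I_n.+2) (Z i @^-1` [set z i])) =
  P (\bigcap_(i in `I_n.+1) (Z i @^-1` [set z i])) *
  J (z n) (z n.+1 - z n)%R.

Let measurable_cylinder m z :
  measurable (\bigcap_(i in `I_m) (Z i @^-1` [set z i])).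
Proof. by apply: bigcap_measurableType => // i _;
  exact: measurable_preimage_int. Qed.

(** Induction on [n] with [m] and [z] free: splitting by the value of $Z_{m+1}$ lengthens the
    cylinder by one step, and the product form of the Markov property supplies the factor [J].
    Cylinders of probability zero need no separate treatment. *)
Lemma cylinder_hit m n z y :
  P (\bigcap_(i in `I_m.+1) (Z i @^-1` [set z i]) `&` Z (m + n)%N @^-1` [set y])
    =
  P (\bigcap_(i in `I_m.+1) (Z i @^-1` [set z i])) * hit J y n (z m).
Proof.
elim: n m z => [|n ih] m z /=.
  have [<-|zy] := eqVneq (z m) y.
    rewrite mule1; congr (P _); apply/setIidPl => t /(_ m).
    by rewrite addn0; apply => /=.
  rewrite mule0 -[RHS](measure0 P); congr (P _); apply/seteqP; split => // t.
  by rewrite addn0 => -[/(_ m (ltnSn m))/= -> /eqP]; rewrite (negPf zy).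
rewrite (probability_partition (mZ m.+1)); last first.
  by apply: measurableI => //; exact: measurable_preimage_int.
rewrite -(@ge0_counting_reindex _ (fun j => z m + j)%R)//.
rewrite -ge0_countingZl//; last by move=> j; rewrite mule_ge0 ?hit_ge0.
apply: eq_integral => j _.
(* The value of [z] at time $m + 1$ is arbitrary, so the path is redefined there to make the jump
   [j]. *)
pose z' i := if i == m.+1 then (z m + j)%R else z i.
have zz' : \bigcap_(i in `I_m.+1) (Z i @^-1` [set z i]) =
           \bigcap_(i in `I_m.+1) (Z i @^-1` [set z' i]).
  by apply: eq_bigcapr => i /= im; rewrite /z' ltn_eqF.
have z'm : z' m = z m by rewrite /z' ltn_eqF.
have z'Sm : z' m.+1 = (z m + j)%R by rewrite /z' eqxx.
have := ih m.+1 z'; rewrite chainZ -zz' z'm z'Sm.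
rewrite [X in J _ X](_ : _ = j) -?muleA; last by ring.
move=> <-; rewrite addSnnS setIAC; congr (P (_ `&` _)).
by rewrite zz' [in RHS]IIS bigcap_setU bigcap_set1 z'Sm.
Qed.

Lemma chain_hit x n y : P (Z 0%N @^-1` [set x]) = 1 ->
  P (Z n @^-1` [set y]) = hit J y n x.
Proof.
move=> Z0.
have c0 : \bigcap_(i in `I_1) (Z i @^-1` [set x]) = Z 0%N @^-1` [set x].
  by rewrite II1 bigcap_set1.
have := @cylinder_hit 0 n (fun=> x) y; rewrite c0 Z0 mul1e add0n => <-.
by rewrite probability_setI1//; exact: measurable_preimage_int.
Qed.

End hitting.

Lemma green_chain (jump : int -> probability int R) x y (Z :
  nat -> {RV P >-> int}) :
  markov_chain_from jump x Z ->
  green P Z y = \sum_(n <oo) hit (fun x j => jump x [set j]) y n x.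
Proof.
move=> [Z0 chainZ]; apply: eq_eseriesr => n _.
by apply: (@chain_hit (fun n => Z n) (fun x j => jump x [set j])).
Qed.

Section walks.
Variables (X : nat -> {RV P >-> int}) (w : probability int R).
Hypothesis Xw : iid_with_law X w.

Lemma measurable_walk n : measurable_fun setT (walk X n).
Proof.
elim: n => [|n ih].
  rewrite (_ : walk X 0 = cst 0%R); first exact: measurable_cst.
  by apply/funext => t; rewrite /walk big_ord0.
move=> _ B _; rewrite setTI; have [e [_ _ esurj]] := bij_nat_int.
(* Since the state space is countable, the event splits according to the value of the walk at time
   [n]. *)
have -> : walk X n.+1 @^-1` B = \bigcup_k
    (walk X n @^-1` [set e k] `&` X n @^-1` [set j | B (e k + j)%R]).
  apply/seteqP; split => [t|t [k _ [/= <-]]]; rewrite /= /walk big_ord_recr//=.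
  have [k _ ek] := esurj (walk X n t) I; exists k => //=; split => //.
  by rewrite /= ek.
apply: bigcupT_measurable => k; apply: measurableI.
  exact: measurable_preimage_int.
by apply: measurable_preimage_int.
Qed.

(** A path from 0 is determined by its increments, so a cylinder of the walk is a cylinder of the
    steps, to which independence applies. This yields the Markov property of the walk. *)
Lemma walk_cylinder n z :
  P (\bigcap_(i in `I_n.+1) (walk X i @^-1` [set z i])) =
  (z 0%N == 0%R)%:R%:E * \prod_(i < n) w [set (z i.+1 - z i)%R].
Proof.
have [z0|z0] := eqVneq; last first.
  rewrite mul0e -[RHS](measure0 P); congr (P _); apply/seteqP; split => // t.
  move=> /(_ 0%N (ltn0Sn n)); rewrite /= /walk big_ord0 => /esym/eqP.
  by rewrite (negPf z0).
have -> : \bigcap_(i in `I_n.+1) (walk X i @^-1` [set z i]) =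
    \bigcap_(i in `I_n) (X i @^-1` [set (z i.+1 - z i)%R]).
  apply/seteqP; split => t Xt i /= ilt.
    have /= <- := Xt i.+1 ilt; have /= <- := Xt i (ltnW ilt).
    by rewrite /walk big_ord_recr/= addrAC subrr add0r.
  elim: i ilt => [|i ih] ilt; first by rewrite /walk big_ord0 z0.
  rewrite /walk big_ord_recr/= -/(walk X i t) ih ?(ltnW ilt)//.
  by rewrite (Xt i)// addrC subrK.
have [Xind Xlaw] := Xw; pose J := [fset val i | i in 'I_n]%fset.
have JE : [set` J] = `I_n.
  apply/seteqP; split => [i /= /imfsetP[/= j _ ->]//|i /= ilt].
  by apply/imfsetP; exists (Ordinal ilt).
have := Xind J (fun i => [set (z i.+1 - z i)%R]); rewrite JE => -> //.
rewrite mul1e big_imfset/=; last by move=> i j _ _ /val_inj.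
by rewrite big_enum/=; apply: eq_bigr => i _; rewrite -(Xlaw i).
Qed.

(** The walk is a chain whose jump law does not depend on the position, so [chain_hit] and
    [hit_walk] give it the law $w^{*n}$ at time $n$. *)
Lemma green_walk y :
  green P (walk X) y = genf (fun k => w [set k]) 1 y.
Proof.
apply: eq_eseriesr => n _; rewrite expr1n mul1e -[y in RHS]subr0 -hit_walk.
apply: chain_hit => //.
- exact: measurable_walk.
- by move=> m z; rewrite !walk_cylinder big_ord_recr/= muleA.
- rewrite -[RHS](@probability_setT _ _ _ P); congr (P _).
  by apply/seteqP; split => // t _ /=; rewrite /walk big_ord0.
Qed.

End walks.

End chains.

(** * Fourier transforms *)

Section mean.
Context {R : realType}.
Implicit Types (c : int -> \bar R) (f g : int -> R).

(** The form with [fine] matches the two parts of [fourier], so that [fourier] and [charfun] are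
    convertible on probability laws. *)
Definition mean c f : R := \int[counting]_(k in [set: int]) (fine (c k) * f k).

Lemma counting_fin_num c : (forall k, 0 <= c k)%E ->
  (\int[counting]_k c k < +oo)%E -> forall k, c k \is a fin_num.
Proof.
move=> c0 coo k; rewrite ge0_fin_numE//; apply: le_lt_trans coo.
rewrite -(@ge0_counting_delta _ c k)//; apply: ge0_le_integral => //.
- by move=> j _; rewrite mule_ge0.
- move=> j _; case: eqP => _; first by rewrite mul1e.
  by rewrite mul0e.
Qed.

Section finite_mass.
Variable c : int -> \bar R.
Hypotheses (c0 : forall k, (0 <= c k)%E) (coo : (\int[counting]_k c k < +oo)%E).

Let cfin := counting_fin_num c0 coo.

Lemma mean_integrable f M : (forall k, `|f k| <= M) ->
  (@counting int R).-integrable setT (EFin \o (fun k => fine (c k) * f k)).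
Proof.
move=> fM.
apply: (@le_integrable _ _ _ _ _ _ _ (fun k => M%:E * c k)%E) => //.
  move=> k _ /=; rewrite -(fineK (cfin k)) -EFinM !abse_EFin lee_fin !normrM.
  by rewrite mulrC ler_wpM2r// (le_trans (fM k))// ler_norm.
apply: integrableZl => //.
apply/integrableP; split => //.
by under eq_integral do rewrite gee0_abs//.
Qed.

Lemma EFin_mean f M : (forall k, 0 <= f k) -> (forall k, f k <= M) ->
  ((mean c f)%:E = \int[counting]_k (c k * (f k)%:E))%E.
Proof.
move=> f0 fM; rewrite /mean /Rintegral fineK.
  by apply: eq_integral => k _; rewrite EFinM fineK.
apply: integrable_fin_num => //; apply: (mean_integrable (M := M)) => k.
by rewrite ger0_norm.
Qed.

Lemma meanD f g M N : (forall k, `|f k| <= M) -> (forall k, `|g k| <= N) ->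
  mean c (fun k => f k + g k) = mean c f + mean c g.
Proof.
move=> fM gN; rewrite /mean -RintegralD//; last 2 first.
- exact: mean_integrable fM.
- exact: mean_integrable gN.
by apply: eq_Rintegral => k _; rewrite mulrDr.
Qed.

Lemma meanZ f r M : (forall k, `|f k| <= M) ->
  mean c (fun k => r * f k) = r * mean c f.
Proof.
move=> fM; rewrite /mean -RintegralZl//; last exact: mean_integrable fM.
by apply: eq_Rintegral => k _; rewrite mulrCA.
Qed.

Lemma mean1 : (mean c (fun=> 1))%:E = (\int[counting]_k c k)%E.
Proof.
by rewrite (EFin_mean (M := 1))//; under eq_integral do rewrite mule1.
Qed.

Lemma le_mean f g M N : (forall k, `|f k| <= M) -> (forall k, `|g k| <= N) ->
  (forall k, f k <= g k) -> mean c f <= mean c g.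
Proof.
move=> fM gN fg; apply: le_Rintegral => //.
- exact: mean_integrable fM.
- exact: mean_integrable gN.
by move=> k _; rewrite ler_wpM2l// fine_ge0.
Qed.

Lemma mean_bound f : (forall k, `|f k| <= 1) -> `|mean c f| <= mean c (fun=> 1).
Proof.
move=> f1; have n1 (k : int) : `|1 : R| <= 1 by rewrite normr1.
rewrite ler_norml -mulN1r -(meanZ _ n1); apply/andP; split.
  apply: (le_mean (M := 1) (N := 1)) => // k;
    first by rewrite normrM normrN !normr1 mul1r.
  by rewrite mulr1; have := f1 k; rewrite ler_norml => /andP[].
by apply: (le_mean (M := 1) (N := 1)) => // k; rewrite (le_trans (ler_norm _)).
Qed.

End finite_mass.

Lemma meanDl (c d : int -> \bar R) (r : R) f M :
  (forall k, 0 <= c k)%E -> (\int[counting]_k c k < +oo)%E ->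
  (forall k, 0 <= d k)%E -> (\int[counting]_k d k < +oo)%E ->
  (forall k, `|f k| <= M) ->
  mean (fun k => c k + r%:E * d k)%E f = mean c f + r * mean d f.
Proof.
move=> c0 coo d0 doo fM; rewrite -(meanZ d0 doo r fM) /mean -RintegralD//;
  last 2 first.
- exact: mean_integrable fM.
- apply: (mean_integrable d0 doo (M := `|r| * M)) => k.
  by rewrite normrM ler_wpM2l.
apply: eq_Rintegral => k _.
have cf := counting_fin_num c0 coo k; have df := counting_fin_num d0 doo k.
by rewrite fineD ?fineM ?fin_numM//= mulrDl mulrCA mulrA.
Qed.

Lemma delta0_total : (\int[counting]_k delta0 k = 1 :> \bar R)%E.
Proof.
rewrite -[RHS](@ge0_counting_delta _ (fun=> 1%E) 0)//=.
by apply: eq_integral => k _; rewrite mule1.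
Qed.

Lemma mean_delta0 f : mean delta0 f = f 0.
Proof.
transitivity (mean delta0 (fun=> f 0 * 1)).
  apply: eq_Rintegral => k _; rewrite /delta0 mulr1.
  by case: eqP => [->//|_] /=; rewrite !mul0r.
have d0 := @delta0_ge0 R; have doo :
  (\int[counting]_k delta0 k < +oo :> \bar R)%E.
  by rewrite delta0_total ltry.
rewrite (meanZ d0 doo _ (M := 1)) => [|k]; last by rewrite normr1.
apply: EFin_inj; rewrite EFinM mean1//.
by rewrite delta0_total mule1.
Qed.

(* Adding the constant 1 to [f] makes it nonnegative, so that [conv_test]
   applies. *)
Lemma mean_conv a b f :
  (forall k, 0 <= a k)%E -> (\int[counting]_k a k < +oo)%E ->
  (forall k, 0 <= b k)%E -> (\int[counting]_k b k < +oo)%E ->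
  (forall k, `|f k| <= 1) ->
  mean (conv a b) f = mean a (fun m => mean b (fun j => f (m + j))).
Proof.
move=> a0 aoo b0 boo f1; have n1 (k : int) : `|1 : R| <= 1 by rewrite normr1.
have c0 := conv_ge0 a0 b0.
have coo := conv_lty a0 b0 aoo boo.
have bf m := mean_bound b0 boo (fun j => f1 (m + j)).
apply: (addIr (mean (conv a b) (fun=> 1))).
rewrite -(meanD c0 coo f1 n1).
have -> : mean (conv a b) (fun=> 1) = mean b (fun=> 1) * mean a (fun=> 1).
  by apply: EFin_inj; rewrite EFinM !mean1// conv_total// muleC.
rewrite -(meanZ a0 aoo _ n1).
rewrite -(meanD a0 aoo bf (N := `|mean b (fun=> 1)|)); last by move=> k;
  rewrite mulr1.
apply: EFin_inj.
have g0 k : 0 <= f k + 1 by rewrite -lerBlDr sub0r; have := f1 k;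
  rewrite ler_norml => /andP[].
have g2 k : f k + 1 <= 2 by rewrite -(natr1 1) lerD2r (le_trans (ler_norm _)).
have bE m : mean b (fun j => f (m + j)) + mean b (fun=> 1) * 1 = mean b (fun j
  => f (m + j) + 1).
  by rewrite (meanD b0 boo _ n1 (M := 1)) ?mulr1.
rewrite (EFin_mean c0 coo g0 g2) (conv_test a0 b0); last by move=> k;
  rewrite lee_fin.
rewrite (EFin_mean a0 aoo (M := mean b (fun=> 2))); last 2 first.
- move=> m; rewrite bE; apply: Rintegral_ge0 => j _.
  by rewrite mulr_ge0 ?fine_ge0.
- move=> m; rewrite bE; apply: (le_mean b0 boo (M := 2) (N := 2)) => // k.
  + by rewrite ger0_norm.
  + by rewrite ger0_norm.
by apply: eq_integral => m _; rewrite bE (EFin_mean b0 boo (M := 2)).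
Qed.

End mean.

(** * Transforms of convolutions and of the measures $A_s$ *)

Section charfun.
Context {R : realType}.
Implicit Types (a b c : int -> \bar R) (t : R).

Definition charfun c t : R[i] :=
  Complex (mean c (fun k => cos (t * k%:~R))) (mean c (fun k => sin (t *
    k%:~R))).

Lemma mean_lin c (f g : int -> R) (r q : R) :
  (forall k, 0 <= c k)%E -> (\int[counting]_k c k < +oo)%E ->
  (forall k, `|f k| <= 1) -> (forall k, `|g k| <= 1) ->
  mean c (fun k => r * f k + q * g k) = r * mean c f + q * mean c g.
Proof.
move=> c0 coo f1 g1.
rewrite (meanD c0 coo (M := `|r| * 1) (N := `|q| * 1)) => [|k|k].
- by rewrite (meanZ c0 coo r f1) (meanZ c0 coo q g1).
- by rewrite normrM ler_wpM2l.
- by rewrite normrM ler_wpM2l.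
Qed.

(** After [mean_conv], the addition formulas make the inner sums linear combinations of $\cos(tm)$
    and $\sin(tm)$, with the transform of [b] as coefficients. *)
Lemma charfun_conv a b t :
  (forall k, 0 <= a k)%E -> (\int[counting]_k a k < +oo)%E ->
  (forall k, 0 <= b k)%E -> (\int[counting]_k b k < +oo)%E ->
  charfun (conv a b) t = charfun a t * charfun b t.
Proof.
move=> a0 aoo b0 boo; rewrite /charfun.
have cm (k : int) : `|cos (t * k%:~R)| <= 1 := cos_max _.
have sm (k : int) : `|sin (t * k%:~R)| <= 1 := sin_max _.
rewrite !mean_conv//.
set cb := mean b (fun k => cos _); set sb := mean b (fun k => sin _).
have -> : (fun m : int => mean b (fun j => cos (t * (m + j)%:~R))) =
          (fun m => cb * cos (t * m%:~R) + - sb * sin (t * m%:~R)).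
  apply/funext => m; rewrite mulrC [- sb * _]mulrC mulrN -mulNr -mean_lin//.
  by apply: eq_Rintegral => j _; rewrite intrD mulrDr cosD mulNr.
have -> : (fun m : int => mean b (fun j => sin (t * (m + j)%:~R))) =
          (fun m => cb * sin (t * m%:~R) + sb * cos (t * m%:~R)).
  apply/funext => m; rewrite mulrC [sb * _]mulrC -mean_lin//.
  by apply: eq_Rintegral => j _; rewrite intrD mulrDr sinD.
rewrite !mean_lin//.
apply/eqP; rewrite eq_complex; apply/andP; split; apply/eqP => /=; ring.
Qed.

(** Each $w^{*k}$ has mass 1, so the total mass is the geometric series, whose partial sums are at
    most $(1-s)^{-1}$. *)
Lemma genf_total (w : int -> \bar R) (s : R) :
  (forall k, 0 <= w k)%E -> (\int[counting]_k w k = 1)%E -> 0 <= s < 1 ->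
  (\int[counting]_k genf w s k < +oo)%E.
Proof.
move=> w0 w1 /andP[s0 s1].
have sk k : (0 <= (s ^+ k)%:E)%E by rewrite lee_fin exprn_ge0.
rewrite integral_nneseries//; last by move=> k m _;
  rewrite mule_ge0 ?convpow_ge0.
rewrite (eq_eseriesr (g := fun k => (s ^+ k)%:E)); last first.
  move=> k _; rewrite ge0_countingZl ?convpow_total ?mule1//.
  exact: convpow_ge0.
apply: (@le_lt_trans _ _ ((1 - s)^-1)%:E); last exact: ltry.
apply: lime_le; first by apply: is_cvg_nneseries => *.
apply: nearW => n; rewrite sumEFin lee_fin -[leRHS]mul1r ler_pdivlMr
  ?subr_gt0//.
rewrite big_mkord mulrC -opprB mulNr -subrX1 opprB gerBl.
exact: exprn_ge0.
Qed.

(** This is the transform of the renewal equation [genf_rec]. It also shows that $1 - s \hat w(t)$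
    does not vanish. *)
Lemma charfun_genf (w : int -> \bar R) (s t : R) :
  (forall k, 0 <= w k)%E -> (\int[counting]_k w k = 1)%E -> 0 <= s < 1 ->
  (1 - (s%:C)%C * charfun w t) * charfun (genf w s) t = 1.
Proof.
move=> w0 w1 s01; have /andP[s0 _] := s01.
have g0 k := genf_ge0 k w0 s0; have goo := genf_total w0 w1 s01.
have woo : (\int[counting]_k w k < +oo)%E by rewrite w1 ltry.
have d0 := @delta0_ge0 R; have doo :
  (\int[counting]_k delta0 k < +oo :> \bar R)%E.
  by rewrite delta0_total ltry.
have coo := conv_lty w0 g0 woo goo.
have cm (k : int) : `|cos (t * k%:~R)| <= 1 := cos_max _.
have sm (k : int) : `|sin (t * k%:~R)| <= 1 := sin_max _.
have gE : charfun (genf w s) t =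
    1 + (s%:C)%C * charfun (conv w (genf w s)) t.
  transitivity (charfun (fun m => delta0 m + s%:E * conv w (genf w s) m)%E t).
    by congr charfun; apply/funext => m; exact: genf_rec.
  rewrite /charfun.
  rewrite !(meanDl s d0 doo (conv_ge0 w0 g0) coo cm) !(meanDl s d0 doo (conv_ge0
    w0 g0) coo sm).
  rewrite !mean_delta0 mulr0 cos0 sin0.
  by apply/eqP; rewrite eq_complex; apply/andP; split; apply/eqP => /=; ring.
rewrite charfun_conv// mulrA in gE.
by rewrite mulrBl mul1r {1}gE addrK.
Qed.

(** With $\hat w(t) = x + iy$, the number $x^2 + y^2$ is the mean of $x \cos(tk) + y \sin(tk)$, and
    this is pointwise at most $(x^2 + y^2 + 1)/2$ because $\cos^2 + \sin^2 = 1$. *)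
Lemma charfun_le1 (w : int -> \bar R) t :
  (forall k, 0 <= w k)%E -> (\int[counting]_k w k = 1)%E ->
  complex.Re (charfun w t) ^+ 2 + complex.Im (charfun w t) ^+ 2 <= 1.
Proof.
move=> w0 w1; have woo : (\int[counting]_k w k < +oo)%E by rewrite w1 ltry.
have m1 : mean w (fun=> 1) = 1 by apply: EFin_inj; rewrite mean1.
rewrite /charfun /=; set x := mean w _; set y := mean w _.
have cm (k : int) : `|cos (t * k%:~R)| <= 1 := cos_max _.
have sm (k : int) : `|sin (t * k%:~R)| <= 1 := sin_max _.
suff : x ^+ 2 + y ^+ 2 <= (x ^+ 2 + y ^+ 2 + 1) / 2 by lra.
set r := (_ + 1) / 2.
have -> : r = mean w (fun=> r * 1).
  by rewrite (meanZ w0 woo _ (M := 1)) ?m1 ?mulr1// => k; rewrite normr1.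
rewrite !expr2 -mean_lin//.
apply: (le_mean w0 woo (M := `|x| + `|y|) (N := `|r|)).
- move=> k; rewrite (le_trans (ler_normD _ _))// !normrM lerD//.
    by rewrite -[leRHS]mulr1 ler_wpM2l.
  by rewrite -[leRHS]mulr1 ler_wpM2l.
- by move=> k; rewrite mulr1.
move=> k; have := cos2Dsin2 (t * k%:~R).
set C := cos _; set S := sin _ => CS; rewrite mulr1 /r.
by have := sqr_ge0 (x - C); have := sqr_ge0 (y - S); nra.
Qed.

End charfun.

(** * Fourier inversion *)

Section fourier_inversion.
Context {R : realType}.
Local Notation leb := (@lebesgue_measure R).

Lemma sin_2pi_int (k : int) : sin (2 * pi * k%:~R) = 0 :> R.
Proof.
have sn n : sin (2 * pi * n%:R) = 0 :> R.
  have := periodicn (@sinD2pi R) n 0; rewrite add0r sin0 => <-.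
  by rewrite mulr_natl mulr_natr.
by case: (intP k) => [|n|n];
  rewrite ?mulr0 ?sin0// ?mulrNz ?mulrN ?sinN ?sn ?oppr0.
Qed.

Lemma lebesgue_measure_0_2pi : leb `[0%R, (2 * pi)%R] = (2 * pi)%:E.
Proof.
by rewrite lebesgue_measure_itv/= lte_fin mulr_gt0 ?pi_gt0// oppr0 adde0.
Qed.

Lemma integrable_0_2pi (f : R -> R) (M : R) : measurable_fun setT f ->
  (forall t, `|f t| <= M) -> leb.-integrable `[0%R, (2 * pi)%R] (EFin \o f).
Proof.
move=> mf fM; apply: measurable_bounded_integrable => //.
- by have := ltry (2 * pi : R); rewrite -lebesgue_measure_0_2pi.
- exact: measurable_funTS.
- exists M; split => [|N MN t _]; first exact: num_real.
  exact: le_trans (fM t) (ltW MN).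
Qed.

(** Orthogonality of the characters, with 1 added to the cosine so that the integrand is nonnegative
    and series of such terms can be integrated term by term. *)
Lemma integral_1Dcos (k : int) :
  (\int[leb]_(t in `[0%R, (2 * pi)%R]) (1 + cos (t * k%:~R))%:E =
   (2 * pi * (1 + (k == 0)%:R))%:E)%E.
Proof.
have pi2 : 0 < 2 * pi :> R by rewrite mulr_gt0// pi_gt0.
have [->|k0] := eqVneq k 0.
  rewrite (eq_integral (cst 2%:E)); last by move=> t _; rewrite mulr0 cos0.
  by rewrite integral_cst//= lebesgue_measure_0_2pi -EFinM mulrC.
have kR : k%:~R != 0 :> R by rewrite intr_eq0.
pose F (t : R) : R := t + sin (t * k%:~R) * (k%:~R)^-1.
have dF (t : R) : is_derive t (1 : R) F (1 + cos (t * k%:~R)).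
  have h1 : is_derive t (1 : R) (fun t : R => t * k%:~R) (k%:~R).
    have := is_deriveZ (k%:~R) (is_derive_id t (1 : R)).
    rewrite (_ : _ \*: _ = fun t => t * k%:~R); last by apply/funext => x;
      exact: mulrC.
    by rewrite /GRing.scale/= mulr1.
  have h2 := @is_derive1_comp R sin (fun t => t * k%:~R) t _ _ (is_derive_sin _)
    h1.
  have := is_deriveD (is_derive_id t (1 : R)) (is_deriveZ (k%:~R^-1) h2).
  rewrite (_ : id + _ = F); last by apply/funext => x; congr (_ + _);
    exact: mulrC.
  by rewrite /GRing.scale/= mulrCA mulVf// mulr1.
rewrite (@continuous_FTC2 _ _ F)//.
- rewrite -EFinB /F mul0r sin0 mul0r addr0 subr0 sin_2pi_int mul0r addr0.
  by rewrite addr0 mulr1.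
- apply: continuous_subspaceT => t; apply: cvgD; first exact: cvg_cst.
  apply: (@continuous_comp _ _ _ (fun t : R => t * k%:~R) cos);
    last exact: continuous_cos.
  exact: mulrr_continuous.
- have cF t : F @ t --> F t.
    by apply: differentiable_continuous; apply/derivable1_diffP; case: (dF t).
  split => [t _||]; first by case: (dF t).
    exact: cvg_at_right_filter.
  exact: cvg_at_left_filter.
- by move=> t _; rewrite derive1E; case: (dF t).
Qed.

Variable c : int -> \bar R.
Hypotheses (c0 : forall k, (0 <= c k)%E) (coo : (\int[counting]_k c k < +oo)%E).

(** Adding the total mass turns a signed sum into a series of nonnegative terms, which serves both
    measurability and termwise integration. *)
Lemma EFin_mean1D (e : nat -> int) (f : int -> R) : set_bij setT setT e ->
  (forall k, `|f k| <= 1) ->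
  ((mean c f + mean c (fun=> 1))%:E =
   \sum_(n <oo) (c (e n) * (1 + f (e n))%:E))%E.
Proof.
move=> ebij f1.
have f1' k : 0 <= 1 + f k by rewrite -lerBlDl sub0r; have := f1 k;
  rewrite ler_norml => /andP[].
have n1 (k : int) : `|1 : R| <= 1 by rewrite normr1.
rewrite addrC -(meanD c0 coo n1 f1).
rewrite (EFin_mean c0 coo (M := 2))//; last first.
  by move=> k; rewrite -(natr1 1) lerD2l (le_trans (ler_norm _)).
by rewrite (ge0_counting_series ebij)// => k; rewrite mule_ge0// lee_fin.
Qed.

Lemma measurable_mean d (T : measurableType d) (f : T -> int -> R) :
  (forall t k, `|f t k| <= 1) -> (forall k, measurable_fun setT (f^~ k)) ->
  measurable_fun setT (fun t => mean c (f t)).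
Proof.
move=> f1 mf; have [e ebij] := bij_nat_int.
rewrite (_ : (fun t => _) = (fun t => (mean c (f t) + mean c (fun=> 1)) - mean c
  (fun=> 1))).
  apply: measurable_funB => //; apply/measurable_EFinP.
  rewrite (_ : _ \o _ = fun t => \sum_(n <oo) (c (e n) * (1 + f t (e
    n))%:E)%E)%E; last first.
    by apply/funext => t /=; exact: EFin_mean1D.
  apply: ge0_emeasurable_sum => [n t _ _|n _].
    rewrite mule_ge0// lee_fin -lerBlDl sub0r.
    by have := f1 t (e n); rewrite ler_norml => /andP[].
  apply: emeasurable_funM => //; apply/measurable_EFinP.
  exact: measurable_funD.
by apply/funext => t; rewrite addrK.
Qed.

Lemma measurable_cos_int (k : int) : measurable_fun setT (fun t :
  R => cos (t * k%:~R)).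
Proof.
apply: continuous_measurable_fun => t.
apply: (@continuous_comp _ _ _ (fun t : R => t * k%:~R) cos);
  last exact: continuous_cos.
exact: mulrr_continuous.
Qed.

Lemma measurable_sin_int (k : int) : measurable_fun setT (fun t :
  R => sin (t * k%:~R)).
Proof.
apply: continuous_measurable_fun => t.
apply: (@continuous_comp _ _ _ (fun t : R => t * k%:~R) sin);
  last exact: continuous_sin.
exact: mulrr_continuous.
Qed.

Lemma measurable_Re_charfun :
  measurable_fun setT (fun t => complex.Re (charfun c t)).
Proof.
by apply: measurable_mean => [t k|k];
  [exact: cos_max|exact: measurable_cos_int].
Qed.

Lemma measurable_Im_charfun :
  measurable_fun setT (fun t => complex.Im (charfun c t)).
Proof.
by apply: measurable_mean => [t k|k];
  [exact: sin_max|exact: measurable_sin_int].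
Qed.

(** Fourier inversion at 0. The real part plus the total mass is integrated term by term; only $k =
    0$ contributes a cosine integral. *)
Lemma integral_Re_charfun :
  (\int[leb]_(t in `[0%R, (2 * pi)%R]) (complex.Re (charfun c t))%:E =
   (2 * pi)%:E * c 0%R)%E.
Proof.
have pi2 : 0 <= 2 * pi :> R by rewrite mulr_ge0// pi_ge0.
have [e ebij] := bij_nat_int.
have cfin := counting_fin_num c0 coo.
have mfin : (\int[counting]_k c k)%E \is a fin_num by rewrite ge0_fin_numE//
  integral_ge0.
have ci : leb.-integrable `[0%R,
  (2 * pi)%R] (EFin \o (fun t => complex.Re (charfun c t))).
  apply: (integrable_0_2pi measurable_Re_charfun (M := mean c (fun=> 1))) => t.
  by apply: mean_bound => // k; exact: cos_max.
have ki : leb.-integrable `[0%R, (2 * pi)%R] (EFin \o (fun=> mean c (fun=> 1))).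
  exact: (integrable_0_2pi (measurable_cst _) (M := `|mean c (fun=> 1)|)).
have H : (\int[leb]_(t in `[0%R, (2 * pi)%R])
     (complex.Re (charfun c t) + mean c (fun=> 1))%:E =
   (2 * pi)%:E * (\int[counting]_k c k) + (2 * pi)%:E * c 0%R)%E.
  under eq_integral => t _ do rewrite (EFin_mean1D ebij (fun k => cos_max _)).
  rewrite integral_nneseries//; first last.
  - move=> n t _; rewrite mule_ge0// lee_fin -lerBlDl sub0r; exact: cos_geN1.
  - move=> n; apply: emeasurable_funM => //; apply/measurable_EFinP.
    by apply: measurable_funD => //; apply: measurable_funTS;
      exact: measurable_cos_int.
  transitivity (\sum_(n <oo) (2 * pi)%:E * (c (e n) + (e n == 0)%:R%:E * c (e
    n)))%E.
    apply: eq_eseriesr => n _; rewrite ge0_integralZl//; last first.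
      apply/measurable_EFinP.
      by apply: measurable_funD => //; apply: measurable_funTS;
        exact: measurable_cos_int.
    rewrite integral_1Dcos -(fineK (cfin (e n))) -!EFinM; congr EFin; ring.
  rewrite nneseriesZl; last by move=> n _; rewrite adde_ge0// mule_ge0.
  rewrite -ge0_muleDr ?integral_ge0//; congr (_ * _)%E.
  rewrite -(ge0_counting_delta 0 c0) -ge0_countingD//; last by move=> k;
    rewrite mule_ge0.
  rewrite (ge0_counting_series ebij)// => k; by rewrite adde_ge0// mule_ge0.
move: H; under eq_integral do rewrite EFinD.
rewrite integralD//= integral_cst//= lebesgue_measure_0_2pi mean1// muleC.
(* The added mass is finite, hence can be subtracted again. *)
move=> /(congr1 (fun x => x - (2 * pi)%:E * \int[counting]_k c k)%E).
by rewrite addeK ?fin_numM// addeAC subee ?fin_numM// add0e.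
Qed.

End fourier_inversion.

(** * Abel's theorem *)

Section abel.
Context {R : realType}.
Local Open Scope ereal_scope.

Lemma near_left1 : \forall s \near (1%R : R)^'-, (0 < s < 1)%R.
Proof.
by near=> s; apply/andP; split; near: s;
  [exact: nbhs_left_gt|exact: nbhs_left_lt].
Unshelve. all: by end_near. Qed.

(** The sum may be infinite. For $s < 1$ the weighted sum is at most $L$; if $B < L$, some partial
    sum $S$ over $n < N$ exceeds $B$, and the weighted sum is at least $s^N S$, which tends to
    $S$. *)
Lemma abel_limit (u : nat -> \bar R) : (forall n, 0 <= u n) ->
  \sum_(n <oo) (s ^+ n)%:E * u n @[s --> (1%R : R)^'-] --> \sum_(n <oo) u n.
Proof.
move=> u0; set L := \sum_(n <oo) u n; set F := fun s => _.
have s01 := near_left1.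
have FL : \forall s \near (1%R : R)^'-, F s <= L.
  near=> s; have /andP[s0 s1] : (0 < s < 1)%R by near: s.
  apply: lee_nneseries => n _;
    first by rewrite mule_ge0// lee_fin exprn_ge0 ?ltW.
  rewrite -[leRHS]mul1e lee_wpmul2r// lee_fin; apply: exprn_ile1; exact: ltW.
have BF (B : R) : B%:E < L -> \forall s \near (1%R : R)^'-, B%:E <= F s.
  move=> BL; have [N BN] : exists N, B%:E < \sum_(n < N) u n.
    apply/not_existsP => h; move: BL; apply/negP; rewrite -leNgt.
    apply: lime_le; first exact: is_cvg_nneseries.
    by apply: nearW => N; rewrite big_mkord leNgt; apply/negP.
  set S := \sum_(n < N) u n in BN.
  have SF : \forall s \near (1%R : R)^'-, (s ^+ N)%:E * S <= F s.
    near=> s; have /andP[s0 s1] : (0 < s < 1)%R by near: s.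
    have sk k : 0 <= (s ^+ k)%:E by rewrite lee_fin exprn_ge0 ?ltW.
    apply: (@le_trans _ _ (\sum_(n < N) (s ^+ n)%:E * u n)).
      rewrite ge0_sume_distrr//; apply: lee_sum => k _.
      by rewrite lee_wpmul2r// lee_fin ler_wiXn2l ?ltW// ltnW.
    rewrite -(big_mkord xpredT (fun n => (s ^+ n)%:E * u n)).
    by apply: nneseries_lim_ge => k _; rewrite mule_ge0.
  have S0 : 0 <= S by exact: sume_ge0.
  have BS : \forall s \near (1%R : R)^'-, B%:E <= (s ^+ N)%:E * S.
    (* The partial sum may itself be [+oo], in which case so is $s^N S$ for every $s > 0$. *)
    case: S BN S0 {SF} => [r||//] BN S0; last first.
      near=> s; have /andP[s0 s1] : (0 < s < 1)%R by near: s.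
      by rewrite gt0_muley ?leey// lte_fin exprn_gt0.
    have : (s ^+ N * r)%R @[s --> (1%R : R)^'-] --> (1 ^+ N * r)%R.
      apply: cvg_at_left_filter; apply: cvgM; last exact: cvg_cst.
      exact: exprn_continuous.
    rewrite expr1n mul1r => cr.
    near=> s; rewrite -EFinM lee_fin; near: s.
    by apply: (cvgr_ge _ cr); rewrite -lte_fin.
  near=> s; apply: (@le_trans _ _ ((s ^+ N)%:E * S)); near: s => //.
have : 0 <= L by exact: nneseries_ge0.
rewrite -/F; case: L FL BF => [l FL BF _|FL BF _|//]; last first.
  by apply/cvgeyPge => A; apply: BF; exact: ltry.
have Ffin : \forall s \near (1%R : R)^'-, F s \is a fin_num.
  near=> s; rewrite fin_numElt; apply/andP; split.
    by apply: (@lt_le_trans _ _ (l - 1)%:E); rewrite ?ltNyr//; near: s;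
      apply: BF; rewrite lte_fin gtrBl.
  by apply: (@le_lt_trans _ _ l%:E); rewrite ?ltry//; near: s.
apply: cvg_EFin => //; apply/cvgrPdist_le => e e0; near=> s.
have Fs : F s \is a fin_num by near: s.
rewrite /= ger0_norm ?subr_ge0 -?lee_fin ?fineK//; last by near: s.
rewrite EFinB fineK// leeBlDr// addeC -leeBlDr// -EFinB; near: s.
by apply: BF; rewrite lte_fin gtrBl.
Unshelve. all: by end_near. Qed.

End abel.

(** * Resolvents *)

Section resolvent.
Context {R : realType}.
Local Notation leb := (@lebesgue_measure R).

Lemma law_total (w : probability int R) : (\int[counting]_k w [set k] = 1)%E.
Proof.
rewrite -(probability_setT w) (@probability_partition _ _ _ w id)//.
by apply: eq_integral => j _; rewrite setTI.
Qed.

Lemma resolvent_charfun (w : int -> \bar R) (s t : R) :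
  (forall k, 0 <= w k)%E -> (\int[counting]_k w k = 1)%E -> 0 <= s < 1 ->
  (1 - (s%:C)%C * charfun w t)^-1 = charfun (genf w s) t.
Proof.
move=> w0 w1 s01; have h := charfun_genf t w0 w1 s01.
have a0 : 1 - (s%:C)%C * charfun w t != 0.
  by apply: contra_eq_neq h => ->; rewrite mul0r eq_sym oner_eq0.
by apply: (mulfI a0); rewrite h divff.
Qed.

(** The product of the two resolvents is the transform of $A_s * B_s$, which has finite mass since
    $s < 1$; inversion recovers its value at 0. *)
Lemma integral_resolvents (mu nu : probability int R) (s : R) : 0 <= s < 1 ->
  (((2 * pi)^-1)%:E * \int[leb]_(t in `[0%R, (2 * pi)%R])
     (complex.Re ((1 - (s%:C)%C * fourier mu t)^-1 *
                  (1 - (s%:C)%C * fourier nu t)^-1))%:E)%E =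
  conv (genf (fun k => mu [set k]) s) (genf (fun k => nu [set k]) s) 0.
Proof.
move=> s01; have s0 : 0 <= s by case/andP: s01.
set m := fun k => mu _; set n := fun k => nu _.
have m0 k : (0 <= m k)%E by []. have n0 k : (0 <= n k)%E by [].
have gm0 k := genf_ge0 k m0 s0; have gn0 k := genf_ge0 k n0 s0.
have gmoo := genf_total m0 (law_total mu) s01.
have gnoo := genf_total n0 (law_total nu) s01.
have c0 := conv_ge0 gm0 gn0.
have coo := conv_lty gm0 gn0 gmoo gnoo.
transitivity (((2 * pi)^-1)%:E * \int[leb]_(t in `[0%R, (2 * pi)%R])
    (complex.Re (charfun (conv (genf m s) (genf n s)) t))%:E)%E.
  congr (_ * _)%E; apply: eq_integral => t _.
  have -> : fourier mu t = charfun m t by [].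
  have -> : fourier nu t = charfun n t by [].
  rewrite (resolvent_charfun t m0 (law_total mu) s01).
  rewrite (resolvent_charfun t n0 (law_total nu) s01).
  by rewrite charfun_conv.
rewrite integral_Re_charfun// muleA -EFinM mulVf ?mul1e//.
by rewrite mulf_neq0// gt_eqF// pi_gt0.
Qed.

End resolvent.

(** * The limit $s \uparrow 1$ for reflected laws *)

Section reflected.
Context {R : realType}.
Local Notation leb := (@lebesgue_measure R).
Variable mu : probability int R.

Local Notation x := (fun t => complex.Re (fourier mu t)).
Local Notation y := (fun t => complex.Im (fourier mu t)).

(** This is $|1 - s \hat\mu(t)|^2$, written through real and imaginary parts. *)
Definition sqr_norm_1B (s t : R) : R := (1 - s * x t) ^+ 2 + (s * y t) ^+ 2.

Local Notation q := sqr_norm_1B.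

Let xy_le1 t : x t ^+ 2 + y t ^+ 2 <= 1.
Proof. by have := charfun_le1 t (fun k => measure_ge0 mu [set k]) (law_total
  mu). Qed.

Let mass_lty : (\int[counting]_k mu [set k] < +oo)%E.
Proof. by rewrite law_total ltry. Qed.

Let mx : measurable_fun setT x.
Proof. exact: (measurable_Re_charfun (fun k => measure_ge0 mu [set k])
  mass_lty). Qed.

Let my : measurable_fun setT y.
Proof. exact: (measurable_Im_charfun (fun k => measure_ge0 mu [set k])
  mass_lty). Qed.

Let q_ge0 s t : 0 <= q s t.
Proof. by rewrite addr_ge0 ?sqr_ge0. Qed.

Let q_gt0 s t : 0 <= s < 1 -> 0 < q s t.
Proof.
move=> /andP[s0 s1]; rewrite ltr_pwDl ?sqr_ge0// exprn_gt0// subr_gt0.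
have x1 : x t <= 1 by have /= := xy_le1 t; have := sqr_ge0 (y t); nra.
by move: x1 => /=; nra.
Qed.

(* With [z := x + i y] in the unit disc, [1 - z = (1 - s z) - (1 - s) z] and
   [(1 - s) |z| <= 1 - s <= |1 - s z|], so that [|1 - z| <= 2 |1 - s z|]. *)
Let q1_le s t : 0 <= s < 1 -> q 1 t <= 4 * q s t.
Proof.
move=> /andP[s0 s1]; rewrite /sqr_norm_1B !mul1r.
have := xy_le1 t; move: (x t) (y t) => u v uv.
have u1 : u <= 1 by have := sqr_ge0 v; nra.
have h1 : (1 - s) ^+ 2 * (u ^+ 2 + v ^+ 2) <= (1 - s * u) ^+ 2 + (s * v) ^+ 2.
  apply: (@le_trans _ _ ((1 - s) ^+ 2)); first by rewrite ler_piMr ?sqr_ge0.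
  apply: (@le_trans _ _ ((1 - s * u) ^+ 2)); last by rewrite lerDl sqr_ge0.
  by rewrite ler_sqr ?nnegrE; nra.
have h2 := sqr_ge0 ((1 - s * u) + (1 - s) * u).
have h3 := sqr_ge0 (s * v - (1 - s) * v).
nra.
Qed.

(** Reflection changes the sign of the sine sum only, so $\hat\nu = \overline{\hat\mu}$ and the two
    resolvents are conjugate. *)
Lemma Re_resolvents_reflected (nu : probability int R) s t :
  (forall A : set int, nu A = mu [set - k | k in A]) -> 0 <= s < 1 ->
  complex.Re ((1 - (s%:C)%C * fourier mu t)^-1 * (1 - (s%:C)%C * fourier nu
    t)^-1) =
  (q s t)^-1.
Proof.
move=> nuE s01.
have nuk (k : int) : nu [set k] = mu [set - k].
  by rewrite nuE image_set1.
have nbij : bijective (fun k : int => - k) by exists (fun k => - k) => k;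
  rewrite opprK.
have -> : fourier nu t = Complex (x t) (- y t).
  rewrite /fourier; congr Complex => /=.
    rewrite /Rintegral -(counting_reindex _ nbij); congr fine.
    by apply: eq_integral => k _; rewrite nuk opprK mulrNz mulrN cosN.
  have sm (k : int) : `|sin (t * k%:~R)| <= 1 := sin_max _.
  rewrite -mulN1r -[X in -1 * X]/(mean (fun k => mu [set k]) _).
  rewrite -(meanZ (fun k => measure_ge0 mu [set k]) mass_lty (-1) sm).
  rewrite /mean /Rintegral -(counting_reindex _ nbij); congr fine.
  by apply: eq_integral => k _; rewrite nuk opprK mulrNz mulrN sinN mulN1r.
have -> : fourier mu t = Complex (x t) (y t) by [].
rewrite -invfM.
rewrite (_ : _ * _ = ((q s t)%:C)%C) -?fmorphV//.
rewrite /sqr_norm_1B; move: (x t) (y t) => u v.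
by apply/eqP; rewrite eq_complex; apply/andP; split; apply/eqP => /=; ring.
Qed.

Lemma cvg_integral_reflected (L : \bar R) :
  (((2 * pi)^-1)%:E * \int[leb]_(t in `[0%R, (2 * pi)%R]) ((q s t)^-1)%:E)%E
    @[s --> (1 : R)^'-] --> L ->
  L = (((2 * pi)^-1)%:E * \int[leb]_(t in `[0%R,
    (2 * pi)%R]) ((q 1 t)%:E)^-1)%E.
Proof.
set c := (2 * pi)^-1 => FL.
have c0 : 0 < c by rewrite invr_gt0 mulr_gt0// pi_gt0.
(* Dominated convergence and Fatou's lemma concern sequences, so the left limit at 1 is tested along
   $s_n = 1 - 1/(n+1)$, which stays in $[0, 1)$. *)
pose s_ n : R := 1 - n.+1%:R^-1.
have s_01 n : 0 <= s_ n < 1.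
  rewrite /s_ subr_ge0 invf_le1// ler1n ltrBlDr ltrDl invr_gt0 ltr0n//.
have s_1 : s_ n @[n --> \oo] --> (1 : R).
  rewrite -[X in _ --> X]subr0; apply: cvgB;
    [exact: cvg_cst|exact: cvg_harmonic].
have s_l : s_ n @[n --> \oo] --> (1 : R)^'-.
  move=> A /= /s_1 [N _ NA]; exists N => // n /= Nn.
  by apply: NA => //; case/andP: (s_01 n).
pose f_ n t : \bar R := ((q (s_ n) t)^-1)%:E.
pose f t : \bar R := ((q 1 t)%:E)^-1%E.
pose K n := (\int[leb]_(t in `[0%R, (2 * pi)%R]) f_ n t)%E.
have KL : (c%:E * K n)%E @[n --> \oo] --> L by exact: (cvg_comp s_ _ s_l FL).
have {KL} : K n @[n --> \oo] --> ((c^-1)%:E * L)%E.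
  have -> : K = fun n => ((c^-1)%:E * (c%:E * K n))%E.
    by apply/funext => n; rewrite muleA -EFinM mulVf ?mul1e// gt_eqF.
  exact: cvgeZl.
move=> KL.
suff -> : (\int[leb]_(t in `[0%R, (2 * pi)%R]) f t = (c^-1)%:E * L)%E.
  by rewrite muleA -EFinM mulfV ?mul1e// gt_eqF.
have mq s : measurable_fun setT (q s).
  apply: measurable_funD; apply: measurable_funX.
    by apply: measurable_funB => //; exact: measurable_funM.
  exact: measurable_funM.
have f_0 n t : (0 <= f_ n t)%E by rewrite lee_fin invr_ge0.
have f0 t : (0 <= f t)%E by rewrite inve_ge0 lee_fin.
have mf_ n : measurable_fun setT (f_ n).
  apply/measurable_EFinP.
  rewrite (_ : (fun t => _) = (fun t => q (s_ n) t `^ (-1))); last first.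
    by apply/funext => t; rewrite powR_inv1.
  exact: measurableT_comp (measurable_powR _) (mq _).
have q_q t : q (s_ n) t @[n --> \oo] --> q 1 t.
  by apply: cvgD; rewrite !expr2; apply: cvgM;
    do ?[apply: cvgB; first exact: cvg_cst]; apply: cvgM => //; exact: cvg_cst.
(* Where $\hat\mu(t) = 1$ the limit is [+oo], the inverse of 0, and the reciprocals of positive
   numbers tending to 0 diverge to it. *)
have f_f t : f_ n t @[n --> \oo] --> f t.
  rewrite /f inver; case: eqVneq => [q0|q0].
    apply/cvgeryP/gtr0_cvgV0.
      by apply: nearW => n; rewrite invr_gt0 q_gt0.
    rewrite (_ : unstable.inv_fun _ = fun n => q (s_ n) t) -?q0//.
    by apply/funext => n; rewrite /= invrK.
  by apply: cvg_EFin; [exact: nearW|exact: cvgV].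
have mf : measurable_fun setT f by apply: (emeasurable_fun_cvg f_) => // t _.
have f_le n t : (f_ n t <= 4%:E * f t)%E.
  rewrite /f inver; case: eqVneq => [_|q0]; first by rewrite gt0_muley ?leey.
  have q1 : 0 < q 1 t by rewrite lt_neqAle eq_sym q0 q_ge0.
  by rewrite lee_fin ler_pdivlMr// mulrC ler_pdivrMr ?q_gt0// q1_le.
have mD : measurable (`[0%R, (2 * pi)%R] : set R) by [].
have [foo|foo] := ltP (\int[leb]_(t in `[0%R, (2 * pi)%R]) f t)%E +oo%E.
  have fi : leb.-integrable `[0%R, (2 * pi)%R] f.
    apply/integrableP; split; first exact: measurable_funTS.
    by under eq_integral do rewrite gee0_abs//.
  have gi : leb.-integrable `[0%R, (2 * pi)%R] (fun t => 4%:E * f t)%E.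
    exact: integrableZl.
  have [||_ _ Kf] := @dominated_convergence _ _ _ leb _ mD f_ f _
    (fun n => measurable_funTS (mf_ n)) (measurable_funTS mf)
    _ gi.
  - by apply: aeW => t _; exact: f_f.
  - by apply: aeW => t n _; rewrite gee0_abs.
  exact: (cvg_unique _ Kf KL).
(* If the limit integral is infinite, Fatou bounds it by the limit of [K], which is therefore
   infinite too. *)
have := fatou leb mD (fun n => measurable_funTS (mf_ n)) (fun n t _ => f_0 n t).
rewrite (cvg_limn_einf_sup KL).1.
under eq_integral do rewrite (cvg_limn_einf_sup (f_f _)).1.
by move: foo; rewrite leye_eq => /eqP ->; rewrite leye_eq => /eqP ->.
Qed.

End reflected.

Theorem proposition6p4 (R : realType) (mu nu : probability int R)
    (mu_supp : mass_support mu `<=` [set k : int | 0 < k])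
    (nu_supp : mass_support nu `<=` [set k : int | k < 0])
    (d : measure_display) (T : measurableType d) (P : probability T R)
    (Z : nat -> {RV P >-> int})
    (Z_chain : markov_chain_from (oscillating_jump mu nu) 0 Z) :
  [/\ (* (i), first formula: (S_n) and (S'_n) are random walks with step laws
         mu and nu *)
      forall (d1 : measure_display) (T1 : measurableType d1)
          (P1 : probability T1 R) (X : nat -> {RV P1 >-> int})
          (d2 : measure_display) (T2 : measurableType d2)
          (P2 : probability T2 R) (Y : nat -> {RV P2 >-> int}),
        iid_with_law X mu -> iid_with_law Y nu ->
        green P Z 0 =
        (\sum_(0 <= m <oo) (green P1 (walk X) m%:Z *
                            green P2 (walk Y) (- m%:Z)))%E,
      (* (i), second formula *)
      (((2 * pi)^-1)%:E * \int[lebesgue_measure]_(t in `[0%R, (2 * pi)%R])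
         (complex.Re ((1 - (s%:C)%C * fourier mu t)^-1 *
                      (1 - (s%:C)%C * fourier nu t)^-1)%R)%:E)%E
        @[s --> (1 : R)^'-] --> green P Z 0
    & (* (ii); the inverse is taken in [0, +oo], with 0^-1 = +oo *)
      (forall A : set int, nu A = mu [set - k | k in A]) ->
      green P Z 0 =
      (((2 * pi)^-1)%:E * \int[lebesgue_measure]_(t in `[0%R, (2 * pi)%R])
         ((Normc.normc (1 - fourier mu t) ^+ 2)%R%:E)^-1)%E ].
Proof.
pose m k := mu [set k]; pose n k := nu [set k].
have m0 k : (0 <= m k)%E by exact: measure_ge0.
have n0 k : (0 <= n k)%E by exact: measure_ge0.
have m_pos (k : int) : k <= 0 -> m k = 0%E.
  move=> k0; apply/eqP/negPn/negP => mk; have := mu_supp k mk.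
  by rewrite /= ltNge k0.
have n_neg (k : int) : 0 <= k -> n k = 0%E.
  move=> k0; apply/eqP/negPn/negP => nk; have := nu_supp k nk.
  by rewrite /= ltNge k0.
have JE : (fun (x j : int) => oscillating_jump mu nu x [set j]) =
    (fun x => if x <= 0 then m else n).
  by apply/funext => x; rewrite /oscillating_jump; case: ifP.
have GZ : green P Z 0 =
    (\sum_(k <oo) hit (fun x => if (x <= 0)%R then m else n) 0%R k 0%R)%E.
  by rewrite (green_chain 0 Z_chain) JE.
have series s (s0 : 0 <= s) := nneseries_hit_oscillating m0 n0 m_pos n_neg s0.
have h0 k : (0 <= hit (fun x => if (x <= 0)%R then m else n) 0%R k 0%R)%E.
  by apply: hit_ge0 => x j; case: ifP.
have limit : (((2 * pi)^-1)%:E * \int[lebesgue_measure]_(t in `[0%R,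
  (2 * pi)%R])
         (complex.Re ((1 - (s%:C)%C * fourier mu t)^-1 *
                      (1 - (s%:C)%C * fourier nu t)^-1)%R)%:E)%E
        @[s --> (1 : R)^'-] --> green P Z 0.
  (* For $s$ close to 1 from the left the integral equals the Abel sum of the return
     probabilities. *)
  rewrite GZ; apply: cvg_trans (abel_limit h0); apply: near_eq_cvg; near=> s.
  have s01 : 0 <= s < 1.
    by have /andP[/ltW -> ->] : 0 < s < 1 by near: s; exact: near_left1.
  by rewrite integral_resolvents// series//; case/andP: s01.
split => //.
- move=> d1 T1 P1 X d2 T2 P2 Y Xmu Ynu.
  transitivity (conv (genf m 1) (genf n 1) 0).
    rewrite -series// GZ; apply: eq_eseriesr => k _.
    by rewrite expr1n mul1e.
  (* The Green function of [mu] vanishes at negative points, which reduces the sum over the integers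
     to $m \ge 0$. *)
  rewrite /conv ge0_counting_nat => [||k k0]; last first.
  - rewrite /genf eseries0 ?mul0e// => j _ _.
    by rewrite convpow_eq0_le ?mule0//; lia.
  - by move=> k; rewrite mule_ge0// genf_ge0.
  apply: eq_eseriesr => k _; rewrite sub0r.
  by rewrite (green_walk Xmu) (green_walk Ynu).
(* The second formula already provides a limit, which only remains to be identified. *)
- move=> nuE; rewrite (@cvg_integral_reflected _ mu (green P Z 0)).
    congr (_ * _)%E; apply: eq_integral => t _; congr (_^-1)%E; congr EFin.
    rewrite /sqr_norm_1B; case: (fourier mu t) => u v /=.
    by rewrite sqr_sqrtr ?addr_ge0 ?sqr_ge0// !mul1r sub0r sqrrN.
  apply: cvg_trans limit; apply: near_eq_cvg; near=> s.
  have s01 : 0 <= s < 1.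
    by have /andP[/ltW -> ->] : 0 < s < 1 by near: s; exact: near_left1.
  congr (_ * _)%E; apply: eq_integral => t _.
  by rewrite (Re_resolvents_reflected t nuE s01).
Unshelve. all: by end_near. Qed.
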